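(* Let $D$ be an integral domain and $\star$ a semistar operation on $D$. The following are equivalent: (1) $D$ is a $\star$-Dedekind domain ($\star$-DD). (2) $\mathrm{Na}(D,\star)$ is a principal ideal domain. (3) $\mathrm{Na}(D,\star)$ is a Dedekind domain. Moreover, when these conditions hold, $\mathrm{Na}(D,\star)=\mathrm{Kr}(D,\star)$.
   Context: Let $D$ be an integral domain with quotient field $K$. $\overline{\boldsymbol F}(D)$ denotes the set of all nonzero $D$-submodules of $K$, and $\boldsymbol f(D)$ the set of nonzero finitely generated $D$-submodules of $K$. A semistar operation on $D$ is a map $\star:\overline{\boldsymbol F}(D)\to\overline{\boldsymbol F}(D)$, $E\mapsto E^\star$, such that for all $0\neq x\in K$ and $E,F\in\overline{\boldsymbol F}(D)$: $(xE)^\star=xE^\star$; $E\subseteq F$ implies $E^\star\subseteq F^\star$; $E\subseteq E^\star$ and $(E^\star)^\star=E^\star$. The semistar operation $\star_f$ is defined by $E^{\star_f}:=\bigcup\{F^\star : F\in\boldsymbol f(D),\ F\subseteq E\}$. A quasi-$\star$-ideal of $D$ is a nonzero ideal $I$ of $D$ with $I=I^\star\cap D$. $D$ is $\star$-Noetherian if it has the ascending chain condition on quasi-$\star$-ideals. A nonzero ideal $I$ of $D$ is $\star$-invertible if $(II^{-1})^\star=D^\star$, where $I^{-1}=\{z\in K: zI\subseteq D\}$. $D$ is a P$\star$MD if each nonzero finitely generated ideal of $D$ is $\star_f$-invertible. $D$ is a $\star$-Dedekind domain ($\star$-DD) if it is $\star$-Noetherian and a P$\star$MD. For a polynomial $h$,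 $\boldsymbol c(h)$ is its content, i.e. the $D$-submodule of $K$ generated by its coefficients. With $N(\star):=\{h\in D[X] : h\neq 0,\ \boldsymbol c(h)^\star=D^\star\}$ (a multiplicative set), the Nagata ring is $\mathrm{Na}(D,\star):=D[X]_{N(\star)}$. The Kronecker function ring is $\mathrm{Kr}(D,\star):=\{f/g : f,g\in D[X]\setminus\{0\}$ and there exists $h\in D[X]\setminus\{0\}$ with $(\boldsymbol c(f)\boldsymbol c(h))^\star\subseteq(\boldsymbol c(g)\boldsymbol c(h))^\star\}\cup\{0\}$. Fields are regarded as principal ideal domains and as Dedekind domains. *)

(* Defs.v *)
From HB Require Import structures.
From mathcomp Require Import all_boot all_order all_algebra.
From mathcomp Require Import boolp classical_sets.

Set Implicit Arguments.
Unset Strict Implicit.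
Unset Printing Implicit Defensive.
Import GRing.Theory.
Local Open Scope classical_set_scope.
Local Open Scope ring_scope.

Definition acc (T : Type) (C : set (set T)) : Prop :=
  forall I : nat -> set T, (forall n, C (I n)) ->
    (forall n, I n `<=` I n.+1) ->
    exists N, forall n, (N <= n)%N -> I n = I N.

(* A domain is represented by a subset R of an ambient field L; its modules   *)
(* and ideals are subsets of L. Submodules and ideals may be zero.            *)
Section Subrings.
Variables (L : fieldType) (R : set L).

Definition subring : Prop := subring_closed [in R].

Definition submodule (E : set L) : Prop :=
  [/\ E 0, (forall x y, E x -> E y -> E (x + y))
    & (forall a x, R a -> E x -> E (a * x))].

Definition ideal (I : set L) : Prop := submodule I /\ I `<=` R.

Definition spanned_by (A : set L) : set L := smallest submodule A.

Definition mulM (E F : set L) : set L :=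
  spanned_by [set x * y | x in E & y in F].

Definition fin_generated (E : set L) : Prop :=
  exists s : seq L, E = spanned_by [set` s].

Definition principal (I : set L) : Prop :=
  exists2 a, R a & I = [set a * r | r in R].

Definition prime_ideal (P : set L) : Prop :=
  [/\ ideal P, P <> R
    & forall x y, R x -> R y -> P (x * y) -> P x \/ P y].

Definition maximal_ideal (M : set L) : Prop :=
  [/\ ideal M, M <> R
    & forall J, ideal J -> M `<=` J -> J = M \/ J = R].

Definition integral_over (z : L) : Prop :=
  exists p : {poly L}, [/\ p \is monic, (forall i, R p`_i) & root p z].

(* The quotients a / b below form the quotient field of R, which may be a     *)
(* proper subfield of L.                                                      *)
Definition integrally_closed : Prop :=
  forall a b, R a -> R b -> b != 0 -> integral_over (a / b) -> R (a / b).

Definition PID : Prop := subring /\ forall I, ideal I -> principal I.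

(* Noetherian, integrally closed, of Krull dimension at most 1; fields are    *)
(* included.                                                                  *)
Definition Dedekind_domain : Prop :=
  [/\ subring, acc ideal, integrally_closed
    & forall P, prime_ideal P -> P <> [set 0] -> maximal_ideal P].

End Subrings.

Definition scale (L : fieldType) (x : L) (E : set L) : set L :=
  [set x * y | y in E].

Section Semistar.
Variable D : idomainType.
Local Notation K := {fraction D}.

Definition dom : set K := range (@tofrac D).

Definition Fbar : set (set K) :=
  [set E | submodule dom E /\ E <> [set 0]].

Definition ffin : set (set K) := [set E | Fbar E /\ fin_generated dom E].

(* Only the values of star on Fbar are meaningful. *)
Definition semistar_operation (star : set K -> set K) : Prop :=
  [/\ forall E, Fbar E -> Fbar (star E),
      forall x E, x != 0 -> Fbar E -> star (scale x E) = scale x (star E),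
      forall E F, Fbar E -> Fbar F -> E `<=` F -> star E `<=` star F,
      forall E, Fbar E -> E `<=` star E
    & forall E, Fbar E -> star (star E) = star E].

Variable star : set K -> set K.

Definition star_fin (E : set K) : set K :=
  \bigcup_(F in [set F | ffin F /\ F `<=` E]) star F.

Definition nonzero_ideal (I : set K) : Prop := ideal dom I /\ I <> [set 0].

Definition quasi_star_ideal (I : set K) : Prop :=
  nonzero_ideal I /\ I = star I `&` dom.

Definition star_Noetherian : Prop := acc quasi_star_ideal.

Definition inv_ideal (I : set K) : set K :=
  [set z | scale z I `<=` dom].

Definition content (h : {poly D}) : set K :=
  spanned_by dom (range (fun i : nat => tofrac h`_i)).

Definition Nset : set {poly D} :=
  [set h | h != 0 /\ star (content h) = star dom].

(* Na(D, star) and Kr(D, star), as subsets of K(X) = Frac(D[X]). *)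
Definition Na : set {fraction {poly D}} :=
  [set tofrac f / tofrac g | f in [set: {poly D}] & g in Nset].

Definition Kr : set {fraction {poly D}} :=
  [set q | exists f g : {poly D},
    [/\ f != 0, g != 0, q = tofrac f / tofrac g
      & exists2 h : {poly D}, h != 0 &
          star (mulM dom (content f) (content h)) `<=`
          star (mulM dom (content g) (content h))]]
  `|` [set 0].

End Semistar.

Definition star_invertible (D : idomainType)
    (star : set {fraction D} -> set {fraction D}) (I : set {fraction D}) : Prop :=
  star (mulM (@dom D) I (inv_ideal I)) = star (@dom D).

Definition PstarMD (D : idomainType)
    (star : set {fraction D} -> set {fraction D}) : Prop :=
  forall I, nonzero_ideal I -> fin_generated (@dom D) I ->
    star_invertible (star_fin star) I.

Definition star_Dedekind (D : idomainType)
    (star : set {fraction D} -> set {fraction D}) : Prop :=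
  star_Noetherian star /\ PstarMD star.

(* Main.v *)
(* Write c(f)* for the star-closure of the content. By induction on degrees   *)
(* (star_Gauss), N(star) is multiplicative and Na(D, star) is a ring. If D is *)
(* a PstarMD and c(f) is inside c(g)*, then f / g lies in Na: invert          *)
(* c(f) + c(g) by finitely many elements and multiply f and g by a polynomial *)
(* carrying these, with gaps between the exponents so that contents multiply. *)
(* This yields Na = Kr; and an ideal J of Na is generated by an f in J with   *)
(* c(f)* maximal, because c(f + X^n g) = c(f) + c(g) for large n.             *)
(*   Conversely, the chain condition of Na descends to quasi-star-ideals I    *)
(* through the extensions I Na. If Na is Dedekind and I is finitely generated, *)
(* then I Na is invertible: 1 = sum_i a_i w_i with the w_i in (I Na)^-1. After *)
(* clearing a denominator g in N(star), the coefficients of the w_i lie in    *)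
(* I^-1 and those of g in I I^-1.                                             *)

Require Import Defs.
From HB Require Import structures.
From mathcomp Require Import all_boot all_order all_algebra.
From mathcomp Require Import boolp classical_sets.
From mathcomp Require Import ring.

Set Implicit Arguments.
Unset Strict Implicit.
Unset Printing Implicit Defensive.
Import GRing.Theory.
Local Open Scope classical_set_scope.
Local Open Scope ring_scope.

(** The implications run (1) => (2) => (3) => (1). Everything passes through contents: a nonzero g
    is a denominator of Na exactly when 1 lies in c(g)* ([NsetP]), and [star_Gauss] cancels such a g
    from a product with coefficients in E*. [Na_divide] turns containment of contents into
    divisibility in Na; it carries both [Na_PID] and [Na_eq_Kr]. In the other direction
    [extension_contract] brings the chain condition down to D, and [Dedekind_invertible], derived
    from the Noetherian, integrally closed and one-dimensional properties, supplies the
    invertibility that [PstarMD_of_Na] reads off coefficientwise. *)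

Lemma acc_maximal (T : Type) (C F : set (set T)) :
  acc C -> F `<=` C -> F !=set0 ->
  exists2 A, F A & forall B, F B -> A `<=` B -> B = A.
Proof.
move=> accC FC [A0 FA0]; apply: contrapT => nomax.
(* Without a maximal member, every member of [F] has a strictly larger one; iterating a choice of
   these contradicts the chain condition. *)
have /choice[next nextP] A :
    exists B, F A -> [/\ F B, A `<=` B & B <> A].
  have [FA|] := pselect (F A); last by exists A.
  apply: contrapT => noB; apply: nomax; exists A => // B FB AB.
  by apply: contrapT => nBA; apply: noB; exists B.
pose chain n := iter n next A0.
have Fchain n : F (chain n) by elim: n => //= n IH; case: (nextP _ IH).
have chainS n : chain n `<=` chain n.+1 by case: (nextP _ (Fchain n)).
have [N chainN] := accC chain (fun n => FC _ (Fchain n)) chainS.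
by case: (nextP _ (Fchain N)) => _ _; apply; apply: (chainN N.+1).
Qed.

Lemma chain_sub (T : Type) (A : nat -> set T) :
  (forall n, A n `<=` A n.+1) -> forall m n, (m <= n)%N -> A m `<=` A n.
Proof.
move=> AS m n; elim: n => [|n IH]; first by rewrite leqn0 => /eqP->.
rewrite leq_eqVlt => /orP[/eqP->//|/IH Amn].
exact: subset_trans Amn (AS n).
Qed.

(** * Principal ideal domains and Dedekind domains inside a field *)

Section Subrings.
Variables (L : fieldType) (R : set L).

Lemma subringP :
  subring R <-> [/\ R 1, forall x y, R x -> R y -> R (x - y)
                  & forall x y, R x -> R y -> R (x * y)].
Proof.
split=> [[R1 RB RM]|[R1 RB RM]].
  split=> [|x y Rx Ry|x y Rx Ry]; first by have := R1; rewrite inE.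
    by have := RB x y; rewrite !inE; apply.
  by have := RM x y; rewrite !inE; apply.
by split=> [|x y|x y]; rewrite !inE //; [apply: RB|apply: RM].
Qed.

Hypothesis subR : subring R.

Lemma subring1 : R 1. Proof. by case/subringP: subR. Qed.

Lemma subringB x y : R x -> R y -> R (x - y).
Proof. by case/subringP: subR => _ + _; apply. Qed.

Lemma subringM x y : R x -> R y -> R (x * y).
Proof. by case/subringP: subR => _ _; apply. Qed.

Lemma subring0 : R 0.
Proof. by rewrite -(subrr 1); apply: subringB; apply: subring1. Qed.

Lemma subringN x : R x -> R (- x).
Proof. by rewrite -sub0r; apply/subringB/subring0. Qed.

Lemma subringD x y : R x -> R y -> R (x + y).
Proof. by move=> Rx Ry; rewrite -[y]opprK; apply/subringB/subringN. Qed.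

Lemma subringX x n : R x -> R (x ^+ n).
Proof.
move=> Rx; elim: n => [|n IH]; first exact: subring1.
by rewrite exprS; apply: subringM.
Qed.

Lemma subring_sum (I : Type) (r : seq I) (P : pred I) (F : I -> L) :
  (forall i, P i -> R (F i)) -> R (\sum_(i <- r | P i) F i).
Proof. by move=> RF; apply: big_ind => //;
  [apply: subring0|apply: subringD]. Qed.

Lemma submodule_subring : submodule R R.
Proof. by split; [apply: subring0|apply: subringD|apply: subringM]. Qed.

Lemma ideal_eq_subring (I : set L) : ideal R I -> I 1 -> I = R.
Proof.
move=> [[_ _ IM] IR] I1; apply/seteqP; split=> // x Rx.
by rewrite -[x]mulr1; apply: IM.
Qed.

Lemma principal_ideal (a : L) : R a -> ideal R [set a * r | r in R].
Proof.
move=> Ra; split; last by move=> _ [r Rr <-]; apply: subringM.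
split.
- by exists 0; [apply: subring0|rewrite mulr0].
- move=> _ _ [r Rr <-] [s Rs <-]; exists (r + s); first exact: subringD.
  by rewrite mulrDr.
- by move=> b _ Rb [r Rr <-]; exists (b * r); [apply: subringM|rewrite mulrCA].
Qed.

Lemma ideal_bigcup_chain (I : nat -> set L) :
  (forall n, ideal R (I n)) -> (forall n, I n `<=` I n.+1) ->
  ideal R (\bigcup_n I n).
Proof.
move=> idI /chain_sub Imono; split; last by move=> x [n _]; apply: (idI n).2.
split; first by exists 0%N => //; case: (idI 0%N) => -[].
- move=> x y [m _ Ix] [n _ Iy]; exists (maxn m n) => //.
  case: (idI (maxn m n)) => -[_ ID _] _.
  by apply: ID; [apply: Imono Ix; apply: leq_maxl|
                 apply: Imono Iy; apply: leq_maxr].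
- by move=> a x Ra [n _ Ix]; exists n => //; case: (idI n) => -[_ _ IM] _;
  apply: IM.
Qed.

(** The union of a chain is principal, and its generator already lies in some stage. *)
Lemma PID_acc : PID R -> acc (ideal R).
Proof.
move=> [_ pid] I idI IS; have := ideal_bigcup_chain idI IS.
move=> /pid[a Ra def_a].
have [N _ IaN] : (\bigcup_n I n) a.
  by rewrite def_a; exists 1; [apply: subring1|rewrite mulr1].
exists N => n Nn; apply/seteqP; split; last exact: (chain_sub IS).
move=> x Ix; have: (\bigcup_n I n) x by exists n.
rewrite def_a => -[r Rr <-]; case: (idI N) => -[_ _ IM] _.
by rewrite mulrC; apply: IM.
Qed.

(* n is the degree of a monic equation of a / b over R. *)
Lemma integral_common_denominator (a b : L) :
  R a -> R b -> b != 0 -> integral_over R (a / b) ->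
  exists n, forall k, R (b ^+ n * (a / b) ^+ k).
Proof.
move=> Ra Rb b0 [p [mon_p Rp rt]]; set z := a / b in rt *.
have [n szp] : exists n, size p = n.+1.
  by exists (size p).-1; rewrite prednK // size_poly_gt0 monic_neq0.
exists n => k; elim/ltn_ind: k => k IH.
have [kn|nk] := leqP k n.
  rewrite /z expr_div_n -(subnK kn) exprD -mulrA [b ^+ k * _]mulrC divfK
    ?expf_neq0 //.
  by apply: subringM; apply: subringX.
have zn : z ^+ n = - \sum_(i < n) p`_i * z ^+ i.
  move: rt; rewrite /root horner_coef szp big_ord_recr /=.
  have -> : p`_n = 1 by move/monicP: mon_p; rewrite /lead_coef szp.
  by rewrite mul1r addrC addr_eq0 => /eqP.
rewrite -(subnK (ltnW nk)) exprD zn !mulrN; apply: subringN.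
rewrite !mulr_sumr; apply: subring_sum => i _.
have -> : b ^+ n * (z ^+ (k - n) * (p`_i * z ^+ i))
        = p`_i * (b ^+ n * z ^+ (k - n + i)) by rewrite exprD; ring.
apply: subringM => //; apply: IH.
by rewrite -ltn_subRL subKn ?(ltnW nk).
Qed.

(* The conductor of R in R[z] is stable under z; if it is generated by d <> 0 *)
(* then z * d = d * r gives z = r.                                            *)
Lemma PID_integrally_closed : PID R -> integrally_closed R.
Proof.
move=> [_ pid] a b Ra Rb b0 intz.
have [n Rn] := integral_common_denominator Ra Rb b0 intz.
set z := a / b in Rn *.
pose J := [set x | forall k, R (x * z ^+ k)].
have idJ : ideal R J.
  split; last by move=> x /(_ 0%N); rewrite mulr1.
  split=> [k|x y Jx Jy k|c x Rc Jx k].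
  - by rewrite mul0r; apply: subring0.
  - by rewrite mulrDl; apply: subringD.
  - by rewrite -mulrA; apply: subringM.
have [d Rd Jd] := pid J idJ.
have : J (b ^+ n) by [].
rewrite Jd => -[r _ db].
have d0 : d != 0.
  by apply: contra_neq (expf_neq0 n b0) => d0; rewrite -db d0 mul0r.
have : J (d * z).
  move=> k; rewrite -mulrA -exprS.
  have : J d by rewrite Jd; exists 1; [apply: subring1|rewrite mulr1].
  exact.
by rewrite Jd => -[s Rs /(mulfI d0) <-].
Qed.

(** For the dimension: if the prime (p) lies in (a), then p = a r. Either a is in (p) and the two
    ideals agree, or r = p s and cancelling p makes a a unit. *)
Lemma PID_Dedekind : PID R -> Dedekind_domain R.
Proof.
move=> pidR; split=> //; [exact: PID_acc|exact: PID_integrally_closed|].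
case: pidR => _ pid P [idP PnR primeP] Pn0; split=> // J idJ PJ.
have [p Rp defP] := pid P idP; have [a Ra defJ] := pid J idJ.
have p0 : p != 0.
  apply/eqP => p0; apply: Pn0; apply/seteqP; split=> x.
    by rewrite defP => -[r _ <-]; rewrite p0 mul0r.
  by move=> ->; case: idP => -[].
have Pp : P p by rewrite defP; exists 1; [apply: subring1|rewrite mulr1].
have := PJ _ Pp; rewrite defJ => -[r Rr pE].
have [|Pa|] := primeP a r Ra Rr; first by rewrite pE.
  left; apply/seteqP; split=> x; last by rewrite -defJ; apply: PJ.
  move=> [s Rs <-].
  by rewrite mulrC; case: idP => -[_ _ PM] _; apply: PM.
rewrite defP => -[s Rs rE]; right; rewrite -defJ; apply: ideal_eq_subring => //.
rewrite defJ; exists s => //; apply: (mulfI p0).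
by rewrite mulr1 -[RHS]pE -rE; ring.
Qed.

(* The ideals of the r_0 c + r_1 c z + ... + r_n c z^n ascend with n; where   *)
(* they become stationary, z satisfies a monic equation over R.               *)
Lemma Noetherian_completely_integrally_closed (c z : L) :
  acc (ideal R) -> integrally_closed R ->
  c != 0 -> (forall n, R (c * z ^+ n)) -> R z.
Proof.
move=> accR icR c0 Rcz.
pose I n := [set x | exists2 r : nat -> L, forall i, R (r i) &
                     x = \sum_(i < n) r i * (c * z ^+ i)].
have idI n : ideal R (I n).
  split; last by move=> _ [r Rr ->]; apply: subring_sum => i _; apply: subringM.
  split.
  - exists (fun=> 0); first by move=> _; apply: subring0.
    by rewrite big1 // => i _; rewrite mul0r.
  - move=> _ _ [r Rr ->] [s Rs ->]; exists (fun i => r i + s i).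
      by move=> i; apply: subringD.
    by rewrite -big_split; apply: eq_bigr => i _; rewrite mulrDl.
  - move=> a _ Ra [r Rr ->]; exists (fun i => a * r i).
      by move=> i; apply: subringM.
    by rewrite mulr_sumr; apply: eq_bigr => i _; rewrite mulrA.
have IS n : I n `<=` I n.+1.
  move=> _ [r Rr ->]; exists (fun i => if (i < n)%N then r i else 0).
    by move=> i; case: ifP => _ //; apply: subring0.
  rewrite big_ord_recr /= ltnn mul0r addr0.
  by apply: eq_bigr => i _; rewrite ltn_ord.
have [N IN] := accR I idI IS.
have : I N.+1 (c * z ^+ N).
  exists (fun i => (i == N)%:R).
    by move=> i; case: (i == N); [apply: subring1|apply: subring0].
  rewrite big_ord_recr /= eqxx mul1r big1 ?add0r // => i _.
  by rewrite (ltn_eqF (ltn_ord i)) mul0r.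
rewrite IN // => -[r Rr czN].
have zE : z = (c * z ^+ 1) / c by rewrite expr1 mulrAC mulfV // mul1r.
have Rc : R c by have := Rcz 0%N; rewrite mulr1.
rewrite zE; apply: icR => //; rewrite -zE.
exists ('X^N - \poly_(i < N) r i); split.
- by rewrite monicE lead_coefDl ?lead_coefXn // size_polyN size_polyXn ltnS
  size_poly.
- move=> i; rewrite coefB coefXn coef_poly; apply: subringB.
    by case: (i == N); [apply: subring1|apply: subring0].
  by case: ifP => _ //; apply: subring0.
rewrite /root !hornerE subr_eq0 horner_poly.
apply/eqP/(mulfI c0); rewrite czN mulr_sumr; apply: eq_bigr => i _; ring.
Qed.

(* With a <> 0 in T and P a maximal ideal over T, an ideal of the form        *)
(* (a : b) that is maximal among those inside P is prime, so it equals P, and *)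
(* z = b / a does the job.                                                    *)
Lemma Dedekind_nonintegral_multiplier (T : set L) :
  Dedekind_domain R -> ideal R T -> T <> R -> T <> [set 0] ->
  exists2 z, ~ R z & forall t, T t -> R (z * t).
Proof.
move=> [_ accR _ dimR] idT TR T0.
have [a Ta a0] : exists2 a, T a & a != 0.
  apply: contrapT => noa; apply: T0; apply/seteqP; split=> x; last first.
    by move=> ->; case: idT => -[].
  move=> Tx; apply: contrapT => x0; apply: noa; exists x => //; exact/eqP.
have Ra : R a by apply: idT.2.
have [P [[idP PR] TP] maxP] := @acc_maximal _ (ideal R)
  [set P | (ideal R P /\ P <> R) /\ T `<=` P] accR
  (fun _ h => h.1.1) (ex_intro _ T (conj (conj idT TR) (@subset_refl _ T))).
pose colon b := [set x | R x /\ [set a * r | r in R] (b * x)].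
have idaR := principal_ideal Ra.
have idcolon b : R b -> ideal R (colon b).
  move=> Rb; case: (idaR) => -[A0 AD AM] AR; split; last by move=> x [].
  split.
  - by split; [apply: subring0|rewrite mulr0].
  - by move=> x y [Rx Ax] [Ry Ay]; split; [apply: subringD|rewrite mulrDr;
    apply: AD].
  - by move=> r x Rr [Rx Ax]; split; [apply: subringM|rewrite mulrCA;
    apply: AM].
have [[PP0 PD PM] PsubR] := idP.
have colonP1 : colon 1 `<=` P.
  move=> x [_]; rewrite mul1r => -[r Rr <-].
  by rewrite mulrC; apply: PM => //; apply: TP.
have [Q [b [Rb -> QP]] maxQ] := @acc_maximal _ (ideal R)
  [set Q | exists b, [/\ R b, Q = colon b & colon b `<=` P]] accR
  (fun _ h => let: ex_intro b (And3 Rb e _) := h in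
     eq_ind_r (ideal R) (idcolon b Rb) e)
  (ex_intro _ (colon 1) (ex_intro _ 1 (And3 subring1 erefl colonP1))).
have colonM c x : R c -> R x -> colon (b * c) x <-> colon b (c * x).
  by move=> Rc Rx; split=> -[Rx' Ax]; split=> //;
    rewrite ?mulrA // -?mulrA //; apply: subringM.
have sub_colonM c : R c -> colon b `<=` colon (b * c).
  move=> Rc x [Rx Ax]; split=> //; rewrite mulrAC mulrC.
  by case: idaR => -[_ _ AM] _; apply: AM.
(* The ideal (P : y) is proper and contains P, so it equals P by maximality. *)
have primeP t y : R t -> R y -> ~ P y -> P (t * y) -> P t.
  move=> Rt Ry nPy Pty; pose J := [set x | R x /\ P (x * y)].
  suff <- : J = P by [].
  apply: maxP; last first.
    by move=> x Px; split; [apply: PsubR|rewrite mulrC; apply: PM].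
  have PJ : P `<=` J.
    by move=> x Px; split; [apply: PsubR|rewrite mulrC; apply: PM].
  split; last exact: subset_trans PJ.
  split.
    split; last by move=> x [].
    split.
    - by split; [apply: subring0|rewrite mul0r].
    - by move=> u v [Ru Pu] [Rv Pv]; split; [apply: subringD|rewrite mulrDl;
      apply: PD].
    - by move=> r u Rr [Ru Pu]; split; [apply: subringM|rewrite -mulrA;
      apply: PM].
  move=> JR; have [] : J 1 by rewrite JR; apply: subring1.
  by rewrite mul1r.
have primary x y : R x -> R y -> ~ P y -> colon b (x * y) -> colon b x.
  move=> Rx Ry nPy Qxy; rewrite -(maxQ (colon (b * y))).
  - by apply/colonM; rewrite // mulrC.
  - exists (b * y); split=> //; first exact: subringM.
    move=> t Ht; have Rt := Ht.1.
    by apply: (primeP t y) => //; rewrite mulrC; apply/QP/colonM.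
  - exact: sub_colonM.
have QnR : colon b <> R.
  move=> QR; apply: PR; apply: ideal_eq_subring => //; apply: QP.
  by rewrite QR; apply: subring1.
have primeQ : prime_ideal R (colon b).
  split=> //; first exact: idcolon.
  move=> x y Rx Ry Qxy.
  (* If (a : bx) stays inside P, maximality makes it equal to (a : b), and it contains y. Otherwise
     it has an element t outside P, and [primary] cancels t from x t. *)
  have [sub|] := pselect (colon (b * x) `<=` P).
    right; rewrite -(maxQ (colon (b * x))); first exact/colonM.
      by exists (b * x); split=> //; apply: subringM.
    exact: sub_colonM.
  move=> /existsNP[t /not_implyP[Ht nPt]]; left.
  by apply: (primary x t) => //; [apply: Ht.1|apply/colonM => //; apply: Ht.1].
have Qa : colon b a by split=> //; exists b => //; rewrite mulrC.
have [|_ _ maxcolon] := dimR _ primeQ.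
  by move=> Q0; move: Qa; rewrite Q0 => /eqP; rewrite (negbTE a0).
have [PQ|//] := maxcolon P idP QP.
exists (b / a) => [Rz|t /TP].
  apply: QnR; apply: ideal_eq_subring; first exact: idcolon.
  split; first exact: subring1.
  by exists (b / a) => //; rewrite mulr1 mulrCA mulfV ?mulr1.
rewrite PQ => -[Rt [r Rr e]].
by rewrite mulrAC -e mulrAC mulfV // mul1r.
Qed.

(** Let I be generated by the a_i and T = I I^-1. If T were proper, some z outside R would satisfy z
    T <= R. Then z I^-1 <= I^-1, so all powers of z lie in I^-1 and have the common denominator
    a_i0; complete integral closedness puts z in R. *)
Lemma Dedekind_invertible (n : nat) (a : 'I_n -> L) :
  Dedekind_domain R -> (forall i, R (a i)) -> (exists i, a i != 0) ->
  exists w : 'I_n -> L,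
    (forall i j, R (w i * a j)) /\ \sum_i a i * w i = 1.
Proof.
move=> dedR Ra [i0 ai0].
pose inv := [set w | forall j, R (w * a j)].
pose T := [set \sum_i a i * w i | w in [set w : 'I_n -> L | forall i, inv (w
  i)]].
have inv0 : inv 0 by move=> j; rewrite mul0r; apply: subring0.
have idT : ideal R T.
  split; last first.
    by move=> _ [w invw <-]; apply: subring_sum => i _; rewrite mulrC;
      apply: invw.
  split.
  - by exists (fun=> 0) => //; rewrite big1 // => i _; rewrite mulr0.
  - move=> _ _ [v invv <-] [w invw <-]; exists (fun i => v i + w i).
      by move=> i j; rewrite mulrDl; apply: subringD; [apply: invv|apply: invw].
    by rewrite -big_split; apply: eq_bigr => i _; rewrite mulrDr.
  - move=> r _ Rr [w invw <-]; exists (fun i => r * w i).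
      by move=> i j; rewrite -mulrA; apply: subringM => //; apply: invw.
    by rewrite mulr_sumr; apply: eq_bigr => i _; rewrite mulrCA.
have Ta i w : inv w -> T (a i * w).
  move=> invw; exists (fun j => if j == i then w else 0).
    by move=> j; case: (j == i).
  rewrite (bigD1 i) //= eqxx big1 ?addr0 // => j /negbTE->.
  by rewrite mulr0.
have inv1 : inv 1 by move=> j; rewrite mul1r.
suff TR : T = R.
  have : T 1 by rewrite TR; apply: subring1.
  by move=> [w invw Tw]; exists w.
apply: contrapT => TR.
have T0 : T <> [set 0].
  move=> T0; have := Ta i0 1 inv1; rewrite T0 mulr1 => /eqP.
  by rewrite (negbTE ai0).
have [z nRz zT] := Dedekind_nonintegral_multiplier dedR idT TR T0.
apply: nRz; have [_ accR icR _] := dedR.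
apply: (@Noetherian_completely_integrally_closed (a i0)) => // k.
suff: inv (z ^+ k) by move=> /(_ i0); rewrite mulrC.
elim: k => [//|k IH] j; rewrite exprS -mulrA; apply: zT.
by rewrite mulrC; apply: Ta.
Qed.

End Subrings.

(** * Spans and products of modules *)

Section Span.
Variables (L : fieldType) (R : set L).

Lemma submodule_spanned (A : set L) : submodule R (spanned_by R A).
Proof.
split=> [E [[]]//|x y Ax Ay E EA|a x Ra Ax E EA];
  have [[E0 ED EM] _] := EA; [apply: ED; [exact: Ax|exact: Ay]|].
by apply: EM => //; apply: Ax.
Qed.

Lemma spanned_gen (A : set L) (x : L) : A x -> spanned_by R A x.
Proof. exact: sub_gen_smallest. Qed.

Lemma spanned_sub (A E : set L) :
  submodule R E -> A `<=` E -> spanned_by R A `<=` E.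
Proof. exact: smallest_sub. Qed.

Lemma submodule_preim_scale (u : L) (E : set L) :
  submodule R E -> submodule R [set x | E (x * u)].
Proof.
move=> [E0 ED EM]; split=> [|x y Ex Ey|a x Ra Ex] /=.
- by rewrite mul0r.
- by rewrite mulrDl; apply: ED.
- by rewrite -mulrA; apply: EM.
Qed.

Lemma mulM_gen (E F : set L) (x y : L) : E x -> F y -> mulM R E F (x * y).
Proof. by move=> Ex Fy; apply: spanned_gen; exists x => //; exists y. Qed.

Lemma mulM_sub (E F G : set L) : submodule R G ->
  (forall x y, E x -> F y -> G (x * y)) -> mulM R E F `<=` G.
Proof.
by move=> subG EFG; apply: spanned_sub => // _ [x Ex [y Fy <-]]; apply: EFG.
Qed.

Lemma submodule_mulM (E F : set L) : submodule R (mulM R E F).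
Proof. exact: submodule_spanned. Qed.

Lemma mulM_mono (E F F' : set L) : F `<=` F' -> mulM R E F `<=` mulM R E F'.
Proof.
move=> FF'; apply: mulM_sub; first exact: submodule_mulM.
by move=> x y Ex /FF'; apply: mulM_gen.
Qed.

(** A product module consists of finite sums. With F = I^-1, this replaces the inverse by finitely
    many of its elements. *)
Lemma mulM_finite_support (E F : set L) (x : L) : mulM R E F x ->
  exists s : seq L, [set` s] `<=` F /\ mulM R E [set` s] x.
Proof.
move: x; apply: mulM_sub.
  split.
  - by exists [::]; split=> //; case: (submodule_mulM E [set` [::]]).
  - move=> x y [s [sF sx]] [t [tF ty]]; exists (s ++ t); split.
      by move=> u /=; rewrite mem_cat => /orP[]; [apply: sF|apply: tF].
    case: (submodule_mulM E [set` s ++ t]) => _ D _; apply: D.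
      by move: sx; apply: mulM_mono => u /= us; rewrite mem_cat us.
    by move: ty; apply: mulM_mono => u /= ut; rewrite mem_cat ut orbT.
  - move=> a x Ra [s [sF sx]]; exists s; split=> //.
    by case: (submodule_mulM E [set` s]) => _ _; apply.
move=> x y Ex Fy; exists [:: y]; split; first by move=> u /=;
  rewrite inE => /eqP->.
by apply: mulM_gen => //=; rewrite inE.
Qed.

Lemma mulM_finite_subset (E F : set L) (t : seq L) : [set` t] `<=` mulM R E F ->
  exists s : seq L, [set` s] `<=` F /\ [set` t] `<=` mulM R E [set` s].
Proof.
elim: t => [|x t IH] tEF; first by exists [::]; split.
have [|s [sF ts]] := IH.
  by move=> u /= ut; apply: tEF; rewrite /= inE ut orbT.
have [|r [rF xr]] := @mulM_finite_support E F x.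
  by apply: tEF; rewrite /= inE eqxx.
exists (r ++ s); split.
  by move=> u /=; rewrite mem_cat => /orP[]; [apply: rF|apply: sF].
move=> u /=; rewrite inE => /orP[/eqP->|ut].
  by move: xr; apply: mulM_mono => v /= vr; rewrite mem_cat vr.
by move: (ts u ut); apply: mulM_mono => v /= vs; rewrite mem_cat vs orbT.
Qed.

End Span.

(** * Contents of polynomials *)

Lemma tofrac_inj (D : idomainType) : injective (@tofrac D).
Proof. by move=> a b /eqP; rewrite tofrac_eq => /eqP. Qed.

Section Content.
Variable D : idomainType.
Local Notation K := {fraction D}.
Local Notation dom := (@dom D).
Implicit Types (E F I : set K) (f g h p q : {poly D}).

Lemma subring_dom : subring dom.
Proof.
apply/subringP; split; first by exists 1; rewrite ?rmorph1.
  by move=> _ _ [a _ <-] [b _ <-]; exists (a - b); rewrite ?rmorphB.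
by move=> _ _ [a _ <-] [b _ <-]; exists (a * b); rewrite ?rmorphM.
Qed.

Lemma dom_tofrac (a : D) : dom (tofrac a).
Proof. by exists a. Qed.

Lemma dom_1 : dom 1.
Proof. exact: subring1 subring_dom. Qed.

Lemma FbarP E : submodule dom E -> Fbar E <-> exists2 x, E x & x != 0.
Proof.
move=> subE; split=> [[_ E0]|[x Ex x0]].
  apply: contrapT => noE; apply: E0; apply/seteqP; split=> x.
    by move=> Ex; apply: contrapT => /eqP x0; apply: noE; exists x.
  by move=> ->; case: subE.
by split=> // E0; move: Ex; rewrite E0 => /eqP; rewrite (negbTE x0).
Qed.

Lemma Fbar_sup E F : submodule dom F -> Fbar E -> E `<=` F -> Fbar F.
Proof.
move=> subF FE EF.
have [x Ex x0] := (FbarP FE.1).1 FE.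
by apply/(FbarP subF); exists x => //; apply: EF.
Qed.

Lemma Fbar_dom : Fbar dom.
Proof.
apply/FbarP; first exact: submodule_subring subring_dom.
by exists 1; [apply: dom_1|apply: oner_neq0].
Qed.

Lemma Fbar_scale (b : K) E : b != 0 -> Fbar E -> Fbar (scale b E).
Proof.
move=> b0 FE; have [[E0 ED EM] _] := FE.
have [x Ex x0] := (FbarP FE.1).1 FE.
apply/FbarP; last by exists (b * x); [exists x|rewrite mulf_neq0].
split.
- by exists 0; rewrite ?mulr0.
- by move=> _ _ [u Eu <-] [v Ev <-]; exists (u + v); rewrite ?mulrDr //;
  apply: ED.
- by move=> a _ Da [u Eu <-]; exists (a * u); [apply: EM|rewrite mulrCA].
Qed.

Lemma Fbar_mulM E F : Fbar E -> Fbar F -> Fbar (mulM dom E F).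
Proof.
move=> FE FF; have [x Ex x0] := (FbarP FE.1).1 FE.
have [y Fy y0] := (FbarP FF.1).1 FF.
apply/FbarP; first exact: submodule_mulM.
by exists (x * y); [apply: mulM_gen|rewrite mulf_neq0].
Qed.

Lemma content_coef h i : content h (tofrac h`_i).
Proof. by apply: spanned_gen; exists i. Qed.

Lemma submodule_content h : submodule dom (content h).
Proof. exact: submodule_spanned. Qed.

Lemma content_sub h E : submodule dom E ->
  (forall i, E (tofrac h`_i)) -> content h `<=` E.
Proof. by move=> subE hE; apply: spanned_sub => // _ [i _ <-]. Qed.

Lemma content_dom h : content h `<=` dom.
Proof.
apply: content_sub; first exact: submodule_subring subring_dom.
by move=> i; apply: dom_tofrac.
Qed.

Lemma Fbar_content h : h != 0 -> Fbar (content h).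
Proof.
move=> h0; apply/FbarP; first exact: submodule_content.
exists (tofrac (lead_coef h)); first exact: content_coef.
by rewrite tofrac_eq0 lead_coef_eq0.
Qed.

Lemma content_fin_generated h : fin_generated dom (content h).
Proof.
exists (map (@tofrac D) h); apply/seteqP; split.
  apply: content_sub; first exact: submodule_spanned.
  move=> i; have [ih|hi] := ltnP i (size h).
    by apply: spanned_gen; apply/map_f/mem_nth.
  rewrite nth_default // rmorph0.
  by case: (submodule_spanned dom [set` map (@tofrac D) h]).
apply: spanned_sub; first exact: submodule_content.
by move=> _ /= /mapP[a /(nthP 0)[i _ <-] ->]; apply: content_coef.
Qed.

Lemma ffin_content h : h != 0 -> ffin (content h).
Proof. by move=> h0; split;
  [apply: Fbar_content|apply: content_fin_generated]. Qed.

Lemma nonzero_ideal_content h : h != 0 -> nonzero_ideal (content h).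
Proof. by move=> /Fbar_content[subh h0]; split=> //; split=> //;
  apply: content_dom. Qed.

(* Since 'X^(size p) * q has no monomial in common with p, the content of the *)
(* sum is the sum of the contents.                                            *)
Definition poly_cat p q : {poly D} := p + 'X^(size p) * q.

Lemma coef_poly_cat p q i :
  (poly_cat p q)`_i = if (i < size p)%N then p`_i else q`_(i - size p).
Proof.
rewrite coefD coefXnM; case: ltnP => [_|hi]; first by rewrite addr0.
by rewrite nth_default // add0r.
Qed.

Lemma content_poly_catl p q : content p `<=` content (poly_cat p q).
Proof.
apply: content_sub; first exact: submodule_content.
move=> i; have [ip|pi] := ltnP i (size p).
  by have := @content_coef (poly_cat p q) i; rewrite coef_poly_cat ip.
by rewrite nth_default // rmorph0; case: (submodule_content (poly_cat p q)).
Qed.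

Lemma content_poly_catr p q : content q `<=` content (poly_cat p q).
Proof.
apply: content_sub; first exact: submodule_content.
move=> i; have := @content_coef (poly_cat p q) (size p + i).
by rewrite coef_poly_cat ltnNge leq_addr /= addnC addnK.
Qed.

Lemma poly_cat_sub p q E : submodule dom E ->
  content p `<=` E -> content q `<=` E -> content (poly_cat p q) `<=` E.
Proof.
move=> subE pE qE; apply: content_sub => // i; rewrite coef_poly_cat.
by case: ifP => _; [apply: pE|apply: qE]; apply: content_coef.
Qed.

Lemma poly_cat_neq0 p q : p != 0 -> poly_cat p q != 0.
Proof.
move=> p0; apply: contra_neq p0 => pq0; apply/eqP.
have := coef_poly_cat p q (size p).-1; rewrite pq0 coef0.
case: ltnP => [_ /esym lp0|].
  by rewrite -lead_coef_eq0 lead_coefE lp0.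
by case sp: (size p) => [|n]; [rewrite -size_poly_eq0 sp|rewrite ltnn].
Qed.

Lemma scaled_poly q (u : K) : (forall i, dom (tofrac q`_i * u)) ->
  exists q1 : {poly D}, forall i, tofrac q1`_i = tofrac q`_i * u.
Proof.
move=> Dqu; have /choice[w wE] i : exists a : D, tofrac a = tofrac q`_i * u.
  by case: (Dqu i) => a _ <-; exists a.
exists (\poly_(i < size q) w i) => i; rewrite coef_poly; case: ltnP => // qi.
by rewrite nth_default // rmorph0 mul0r.
Qed.

End Content.

Lemma subf_div (L : fieldType) (x y z t : L) : y != 0 -> t != 0 ->
  x / y - z / t = (x * t - z * y) / (y * t).
Proof. by move=> y0 t0; rewrite -mulNr addf_div // mulNr. Qed.

Lemma div_eq (L : fieldType) (x y z t : L) : y != 0 -> t != 0 ->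
  x * t = y * z -> x / y = z / t.
Proof. by move=> y0 t0 e; apply/eqP; rewrite eqr_div // e mulrC. Qed.

Lemma numer_eq (L : fieldType) (x y q : L) : y != 0 -> x / y = q -> x = y * q.
Proof. by move=> y0 <-; rewrite mulrC divfK. Qed.

Lemma mulf_divK (L : fieldType) (x y z : L) : x != 0 -> x * (y / x * z) = y * z.
Proof. by move=> x0; rewrite mulrA mulrCA mulfV // mulr1. Qed.

Lemma mulACAC (L : fieldType) (w x y z : L) : w * x * y * z = w * z * y * x.
Proof. ring. Qed.

(** * Semistar closures and the Nagata ring *)

Section Nagata.
Variable D : idomainType.
Local Notation K := {fraction D}.
Local Notation dom := (@dom D).
Variable star : set K -> set K.
Hypothesis hstar : semistar_operation star.
Implicit Types (E F I : set K) (f g h p q : {poly D}).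

Lemma Fbar_star E : Fbar E -> Fbar (star E).
Proof. by case: hstar => H _ _ _ _; apply: H. Qed.

Lemma star_ext E : Fbar E -> E `<=` star E.
Proof. by case: hstar => _ _ _ H _; apply: H. Qed.

Lemma star_mono E F : Fbar E -> Fbar F -> E `<=` F -> star E `<=` star F.
Proof. by case: hstar => _ _ H _ _; apply: H. Qed.

Lemma star_least E F : Fbar E -> Fbar F -> E `<=` star F -> star E `<=` star F.
Proof.
move=> FE FF EF; have [_ _ _ _ idem] := hstar; rewrite -[star F]idem //.
by apply: star_mono => //; apply: Fbar_star.
Qed.

Lemma submodule_star E : Fbar E -> submodule dom (star E).
Proof. by move=> /Fbar_star[]. Qed.

(** Closure commutes with scaling by b, so b F <= E* extends to b F* <= E*. The case b = 0 is
    separate because star is homogeneous only for nonzero scalars. *)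
Lemma star_scale_mem E F (b y : K) : Fbar E -> Fbar F ->
  (forall x, F x -> star E (b * x)) -> star F y -> star E (b * y).
Proof.
move=> FE FF bF Fy; have [->|b0] := eqVneq b 0.
  by rewrite mul0r; case: (submodule_star FE).
have sub : scale b F `<=` star E by move=> _ [x Fx <-]; apply: bF.
apply: (star_least (Fbar_scale b0 FF) FE sub).
by case: hstar => _ scal _ _ _; rewrite scal //; exists y.
Qed.

Lemma star_eq_dom E : Fbar E -> E `<=` dom -> star E = star dom <-> star E 1.
Proof.
move=> FE ED; split=> [->|E1]; first by apply: (star_ext (Fbar_dom D));
  apply: dom_1.
apply/seteqP; split; first exact: star_mono (Fbar_dom D) ED.
apply: star_least => //; first exact: Fbar_dom.
by move=> a Da; rewrite -[a]mulr1; case: (submodule_star FE) => _ _; apply.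
Qed.

Lemma NsetP h : Nset star h <-> h != 0 /\ star (content h) 1.
Proof.
split=> -[h0 Hh]; split=> //;
  first exact/(star_eq_dom (Fbar_content h0) (@content_dom _ h)).
exact/(star_eq_dom (Fbar_content h0) (@content_dom _ h)).
Qed.

Lemma Nset1 : Nset star 1.
Proof.
apply/NsetP; split; first exact: oner_neq0.
apply: star_ext; first exact/Fbar_content/oner_neq0.
by have := @content_coef _ (1 : {poly D}) 0%N; rewrite coef1 rmorph1.
Qed.

(** The polynomials of D[X] that lie in E[X]. *)
Definition coefs_in E p := forall k, E (tofrac p`_k).

Section CoefsIn.
Variable E : set K.
Hypothesis subE : submodule dom E.

Lemma coefs_in0 : coefs_in E 0.
Proof. by move=> k; rewrite coef0 rmorph0; case: subE. Qed.

Lemma coefs_inD p q : coefs_in E p -> coefs_in E q -> coefs_in E (p + q).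
Proof. by move=> Ep Eq k; rewrite coefD rmorphD; case: subE => _ ED _;
  apply: ED; [apply: Ep|apply: Eq]. Qed.

Lemma coefs_inM p q : coefs_in E q -> coefs_in E (p * q).
Proof.
move=> Eq k; have [E0 ED EM] := subE.
rewrite coefM rmorph_sum; apply: big_ind => // i _.
by rewrite rmorphM; apply: EM; [apply: dom_tofrac|apply: Eq].
Qed.

Lemma coefs_inN p : coefs_in E p -> coefs_in E (- p).
Proof. by move=> Ep; rewrite -mulN1r; apply: coefs_inM. Qed.

Lemma coefs_inB p q : coefs_in E p -> coefs_in E q -> coefs_in E (p - q).
Proof. by move=> Ep Eq; apply/coefs_inD/coefs_inN. Qed.

End CoefsIn.

Lemma size_drop_lead (R : nzRingType) (p : {poly R}) (n : nat) :
  (size p <= n.+1)%N -> (size (p - p`_n *: 'X^n)%R <= n)%N.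
Proof.
move=> sp; apply/leq_sizeP => j; rewrite leq_eqVlt => /orP[/eqP<-|nj].
  by rewrite coefB coefZ coefXn eqxx mulr1 subrr.
rewrite coefB coefZ coefXn gtn_eqF // mulr0 subr0 nth_default //.
exact: leq_trans sp nj.
Qed.

(* With a and b the top coefficients of h and g, a * b is in E* since it is a *)
(* coefficient of h * g, and induction on the degree of g applies to          *)
(* a * (g - b * 'X^n). This gives a * g in E*[X], so that the leading term of *)
(* h can be dropped; h starts as f and loses its terms one after the other.   *)
Lemma star_Gauss f g E : Fbar E -> f != 0 -> star (content f) 1 ->
  coefs_in (star E) (f * g) -> coefs_in (star E) g.
Proof.
move=> FE f0 f1; have subE := submodule_star FE.
have [n] := ubnP (size g); elim: n g => // n IH g; rewrite ltnS => sg Efg.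
have coef_h m : forall h, (size h <= m)%N -> coefs_in (star E) (h * g) ->
    forall i, coefs_in (star E) (h`_i *: g).
  elim: m => [|m IHm] h sh Ehg i.
    move: sh; rewrite leqn0 size_poly_eq0 => /eqP->.
    by rewrite coef0 scale0r; apply: coefs_in0.
  have Etop : coefs_in (star E) (h`_m *: g).
    case: n IH sg => [|n] IH sg.
      move: sg; rewrite leqn0 size_poly_eq0 => /eqP->.
      by rewrite scaler0; apply: coefs_in0.
    have Elead : coefs_in (star E) (h`_m * g`_n)%:P.
      move=> k; rewrite coefC; case: eqP => [_|_]; last first.
        by rewrite rmorph0; case: subE.
      (* The size bounds on h and g kill every other product of total degree m + n. *)
      have -> : h`_m * g`_n = (h * g)`_(m + n).
        rewrite coefM; have lt_m : (m < (m + n).+1)%N by rewrite ltnS leq_addr.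
        rewrite (bigD1 (Ordinal lt_m)) //= addKn big1 ?addr0 // => j jm.
        have [mj|] := ltnP m j;
          first by rewrite nth_default ?mul0r // (leq_trans sh).
        rewrite leq_eqVlt => /orP[/eqP e|ltjm]; first by case/eqP: jm;
          apply: val_inj.
        rewrite [g`_ _]nth_default ?mulr0 // (leq_trans sg) //.
        by rewrite ltn_subRL ltn_add2r.
      exact: Ehg.
    have -> : h`_m *: g = h`_m *: (g - g`_n *: 'X^n) + 'X^n * (h`_m * g`_n)%:P.
      rewrite -!mul_polyC polyCM; ring.
    apply: coefs_inD => //; last exact: coefs_inM.
    apply: IH.
      by rewrite ltnS (leq_trans (size_scale_leq _ _)) ?size_drop_lead.
    have -> : f * (h`_m *: (g - g`_n *: 'X^n)) =
        (h`_m)%:P * (f * g) - (f * 'X^n) * (h`_m * g`_n)%:P.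
      rewrite -!mul_polyC polyCM; ring.
    by apply: coefs_inB => //; apply: coefs_inM.
  have [->//|im] := eqVneq i m.
  have := IHm (h - h`_m *: 'X^m) (size_drop_lead sh) _ i.
  rewrite coefB coefZ coefXn (negbTE im) mulr0 subr0; apply.
  have -> : (h - h`_m *: 'X^m) * g = h * g - 'X^m * (h`_m *: g).
    rewrite -!mul_polyC; ring.
  by apply: coefs_inB => //; apply: coefs_inM.
(* For a coefficient b of g, now b c(f) <= E*; since 1 is in c(f)*, b is in E*. *)
move=> k; rewrite -[tofrac _]mulr1.
apply: (star_scale_mem FE (Fbar_content f0)) f1 => x cx; rewrite mulrC.
move: x cx; apply: content_sub => [|i]; first exact: submodule_preim_scale.
have := coef_h (size f) f (leqnn _) Efg i k.
by rewrite /= -rmorphM coefZ.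
Qed.

(** [star_Gauss] with E = c(fg) gives c(g) <= c(fg)*, so 1 passes from c(g)* to c(fg)*. *)
Lemma NsetM f g : Nset star f -> Nset star g -> Nset star (f * g).
Proof.
move=> /NsetP[f0 f1] /NsetP[g0 g1]; have fg0 : f * g != 0 by rewrite mulf_neq0.
apply/NsetP; split=> //; have Ffg := Fbar_content fg0.
apply: (star_least (Fbar_content g0) Ffg) g1.
apply: content_sub => [|k]; first exact: submodule_star.
apply: (star_Gauss Ffg f0 f1) => i.
by apply: star_ext => //; apply: content_coef.
Qed.

Lemma Nset_prod (I : finType) (P : pred I) (g : I -> {poly D}) :
  (forall i, Nset star (g i)) -> Nset star (\prod_(i | P i) g i).
Proof. by move=> Ng; apply: big_ind => //; [apply: Nset1|apply: NsetM]. Qed.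

Lemma Nset_neq0 g : Nset star g -> (tofrac g : {fraction {poly D}}) != 0.
Proof. by case=> g0 _; rewrite tofrac_eq0. Qed.

Lemma Na_frac f g : Nset star g -> Na star (tofrac f / tofrac g).
Proof. by move=> Ng; exists f => //; exists g. Qed.

Lemma Na_poly f : Na star (tofrac f).
Proof. by have := Na_frac f Nset1; rewrite rmorph1 divr1. Qed.

Lemma subring_Na : subring (Na star).
Proof.
apply/subringP; split; first by rewrite -(rmorph1 (@tofrac {poly D}));
  apply: Na_poly.
  move=> _ _ [f _ [g Ng <-]] [f' _ [g' Ng' <-]].
  have g0 := Nset_neq0 Ng; have g0' := Nset_neq0 Ng'.
  rewrite (subf_div _ _ g0 g0');
    have := Na_frac (f * g' - f' * g) (NsetM Ng Ng').
  by rewrite rmorphB !rmorphM.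
move=> _ _ [f _ [g Ng <-]] [f' _ [g' Ng' <-]].
rewrite mulf_div; have := Na_frac (f * f') (NsetM Ng Ng').
by rewrite !rmorphM.
Qed.

Lemma Na_common_denominator (I : finType) (q : I -> {fraction {poly D}}) :
  (forall i, Na star (q i)) ->
  exists2 g, Nset star g & forall i, exists f, q i * tofrac g = tofrac f.
Proof.
move=> Naq; have /choice[d dP] i : exists d, Nset star d /\ exists f, q i *
  tofrac d = tofrac f.
  case: (Naq i) => f _ [d Nd <-]; exists d; split=> //; exists f.
  by rewrite divfK // Nset_neq0.
exists (\prod_i d i); first by apply: Nset_prod => i; case: (dP i).
move=> i; case: (dP i) => _ [f qf].
exists (f * \prod_(j | j != i) d j).
by rewrite (bigD1 i) //= !rmorphM /= mulrA qf.
Qed.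

(** * Star-invertibility and division in the Nagata ring *)

Definition star_splits I (s : seq K) :=
  [/\ [set` s] `<=` inv_ideal I, Fbar (mulM dom I [set` s])
    & star (mulM dom I [set` s]) 1].

(** Since 1 lies in (I I^-1) closed under [star_fin], it lies in F* for a finitely generated F <= I
    I^-1, and the generators of F involve only finitely many elements of I^-1. *)
Lemma PstarMD_splits I : PstarMD star -> nonzero_ideal I -> fin_generated dom I
  ->
  exists s, star_splits I s.
Proof.
move=> pmd nzI fgI; have : star_fin star dom 1.
  exists dom; last by apply: (star_ext (Fbar_dom D)); apply: dom_1.
  split=> //; split; first exact: Fbar_dom.
  exists [:: 1]; apply/seteqP; split.
    move=> a Da; rewrite -[a]mulr1.
    have [_ _ M] := submodule_spanned dom [set` [:: 1 : K]].
    by apply: M => //; apply: spanned_gen; rewrite /= inE.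
  apply: spanned_sub; first exact: submodule_subring (subring_dom D).
  by move=> x /=; rewrite inE => /eqP->; apply: dom_1.
rewrite -(pmd I nzI fgI) => -[F [[FF [t Ft]] FII] F1].
have [|s [sI ts]] := @mulM_finite_subset _ dom I (inv_ideal I) t.
  by move=> x tx; apply: FII; rewrite Ft; apply: spanned_gen.
have FIs : F `<=` mulM dom I [set` s].
  by rewrite Ft; apply: spanned_sub => //; apply: submodule_mulM.
have FFIs := Fbar_sup (submodule_mulM _ _ _) FF FIs.
by exists s; split=> //; apply: star_mono F1.
Qed.

(* Multiplying f and g by the polynomial with coefficients s, spread out so   *)
(* that all products of coefficients of g and elements of s occur in G.       *)
Lemma sparse_multiple f g (s : seq K) :
  (forall u, u \in s -> coefs_in [set x | dom (x * u)] f /\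
                       coefs_in [set x | dom (x * u)] g) ->
  exists F G : {poly D}, f * G = g * F /\
    forall u, u \in s -> coefs_in [set x | content G (x * u)] g.
Proof.
elim: s => [|u s IH] fgs; first by exists 0, 0; rewrite !mulr0.
have [|F [G [fG Gs]]] := IH; first by move=> v vs; apply: fgs;
  rewrite inE vs orbT.
have [/scaled_poly[F1 F1E] /scaled_poly[G1 G1E]] := fgs u (mem_head u s).
have fG1 : f * G1 = g * F1.
  apply: (map_inj_poly (@tofrac_inj D) (rmorph0 _)); rewrite !rmorphM /=.
  have -> : map_poly (@tofrac D) G1 = u *: map_poly (@tofrac D) g.
    by apply/polyP => i; rewrite coefZ !coef_map /= G1E mulrC.
  have -> : map_poly (@tofrac D) F1 = u *: map_poly (@tofrac D) f.
    by apply/polyP => i; rewrite coefZ !coef_map /= F1E mulrC.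
  by rewrite -!scalerAr mulrC.
exists (F + 'X^(size G) * F1), (poly_cat G G1); split.
  by rewrite /poly_cat !mulrDr fG !(mulrCA _ 'X^_) fG1.
move=> v; rewrite inE => /orP[/eqP->|vs] i /=.
  by rewrite -G1E; apply: content_poly_catr; apply: content_coef.
by apply: content_poly_catl; apply: Gs.
Qed.

(** Rewrite f / g as F / G, where c(G) contains c(g) u for each u in [s]. As [s] inverts c(p) = c(f)
    + c(g), which lies in c(g)*, the closure c(G)* contains c(p) [s] and hence 1. *)
Lemma Na_divide f g : PstarMD star -> g != 0 ->
  content f `<=` star (content g) -> Na star (tofrac f / tofrac g).
Proof.
move=> pmd g0 fg; have Fg := Fbar_content g0; set p := poly_cat g f.
have p0 : p != 0 by apply: poly_cat_neq0.
have [s [sI Fps s1]] := PstarMD_splits pmd (nonzero_ideal_content p0)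
  (content_fin_generated p).
have Dps u x : u \in s -> content p x -> dom (x * u).
  by move=> us px; apply: (sI u us); exists x => //; rewrite mulrC.
have [u us|F [G [fG Gs]]] := @sparse_multiple f g s.
  split=> i; apply: Dps => //.
    by apply: content_poly_catr; apply: content_coef.
  by apply: content_poly_catl; apply: content_coef.
have subG : submodule dom (content G) := submodule_content G.
have gG x u : u \in s -> content g x -> content G (x * u).
  move=> us; move: x; apply: content_sub; first exact: submodule_preim_scale.
  exact: Gs.
(* If G = 0 then c(g) u = 0 for all u in [s], so [s] would consist of zeros although c(p) [s] is
   nonzero. *)
have G0 : G != 0.
  apply/eqP => G0; have sub0 : submodule dom [set 0 : K].
    by split=> // [x y -> ->|a x _ ->] /=; rewrite ?addr0 ?mulr0.
  have content0 : content G `<=` [set 0].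
    by apply: content_sub => // i; rewrite G0 coef0 rmorph0.
  have [x gx x0] := (FbarP Fg.1).1 Fg.
  have [y psy /eqP] := (FbarP Fps.1).1 Fps; apply.
  apply: (mulM_sub sub0) psy => z u _ us.
  have /eqP := content0 _ (gG x u us gx).
  by rewrite mulf_eq0 (negbTE x0) => /eqP->; rewrite mulr0.
have FG := Fbar_content G0.
have NG : Nset star G.
  apply/NsetP; split=> //; apply: (star_least Fps FG) s1.
  apply: mulM_sub; first exact: submodule_star.
  move=> x u px us; rewrite mulrC; apply: (star_scale_mem FG Fg) => [y gy|].
    by rewrite mulrC; apply: star_ext => //; apply: gG.
  move: x px; apply: poly_cat_sub => //; first exact: submodule_star.
  exact: star_ext.
have -> : tofrac f / tofrac g = tofrac F / tofrac G :> {fraction {poly D}}.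
  apply: div_eq; [by rewrite tofrac_eq0|exact: Nset_neq0|].
  by have := congr1 (@tofrac {poly D}) fG; rewrite !rmorphM.
exact: Na_frac.
Qed.

(** A denominator g of Na has c(g)* = D*, so h = 1 shows that f / g is in Kr. Conversely c(h) is
    star-invertible and can be cancelled, leaving c(f) <= c(g)*, and [Na_divide] applies. *)
Lemma Na_eq_Kr : PstarMD star -> Na star = Kr star.
Proof.
move=> pmd; apply/seteqP; split=> q.
  move=> [f _ [g [g0 Ng] <-]]; have [->|f0] := eqVneq f 0.
    by right; rewrite /= rmorph0 mul0r.
  left; exists f, g; split=> //; exists 1; first exact: oner_neq0.
  have F1 := Fbar_content (oner_neq0 {poly D}).
  have Ff := Fbar_content f0; have Fg := Fbar_content g0.
  have Fg1 := Fbar_mulM Fg F1.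
  have g1 : star (mulM dom (content g) (content 1)) 1.
    have : star (content g) 1 by rewrite Ng;
      apply: star_ext (Fbar_dom D) _ (dom_1 D).
    apply: star_mono => // x gx; rewrite -[x]mulr1; apply: mulM_gen => //.
    by have := @content_coef _ (1 : {poly D}) 0%N; rewrite coef1 rmorph1.
  apply: star_least => //; first exact: Fbar_mulM.
  have [_ _ M] := submodule_star Fg1; apply: mulM_sub;
    first exact: submodule_star.
  move=> x y fx y1; rewrite -[_ * y]mulr1; apply: M => //.
  by apply: (subringM (subring_dom D));
    [apply: content_dom fx|apply: content_dom y1].
move=> [[f [g [f0 g0 -> [h h0 fgh]]]]|->]; last first.
  exact: subring0 subring_Na.
apply: Na_divide => //.
have Fh := Fbar_content h0; have Ff := Fbar_content f0;
  have Fg := Fbar_content g0.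
have [s [sI Fs s1]] :=
  PstarMD_splits pmd (nonzero_ideal_content h0) (content_fin_generated h).
(* The cancellation: 1 is in (c(h) [s])*, and for x in c(h) and u in [s], a x lies in (c(g) c(h))*
   while u c(h) <= D, so u a x lies in c(g)*. *)
move=> a fa; rewrite -[a]mulr1; apply: (star_scale_mem Fg Fs) s1 => y hsy.
rewrite mulrC; move: y hsy; apply: mulM_sub.
  by apply: submodule_preim_scale; apply: submodule_star.
move=> x u hx us /=.
have -> : x * u * a = u * (a * x) by ring.
apply: (star_scale_mem Fg (Fbar_mulM Fg Fh)); last first.
  apply: fgh; apply: star_ext; first exact: Fbar_mulM.
  exact: mulM_gen.
move=> z ghz; apply: star_ext => //; rewrite mulrC; move: z ghz;
  apply: mulM_sub.
  by apply: submodule_preim_scale; apply: submodule_content.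
move=> v w gv hw /=; rewrite -mulrA mulrC.
have [_ _ M] := submodule_content g; apply: M => //; apply: (sI u us).
by exists w => //; rewrite mulrC.
Qed.

Lemma Na_PID : star_Dedekind star -> PID (Na star).
Proof.
move=> [noeth pmd]; split; first exact: subring_Na.
move=> J [[J0 JD JM] JNa].
have [[q Jq q0]|noq] := pselect (exists2 q, J q & q != 0); last first.
  exists 0; first exact: subring0 subring_Na.
  apply/seteqP; split=> x; last by move=> [r _ <-]; rewrite mul0r.
  move=> Jx; exists 0; first exact: subring0 subring_Na.
  rewrite mul0r; apply/esym/eqP; apply: contrapT => x0; apply: noq.
  by exists x => //; apply/negP.
have numer x : J x -> exists f d, [/\ Nset star d, J (tofrac f),
    x = tofrac f / tofrac d & tofrac f = tofrac d * x].
  move=> Jx; have [f _ [d Nd xE]] := JNa x Jx.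
  have fE := numer_eq (Nset_neq0 Nd) xE.
  by exists f, d; split=> //; rewrite fE; apply: JM => //; apply: Na_poly.
have [f [fnz Jf] fmax] : exists2 f, f != 0 /\ J (tofrac f) &
    forall g, J (tofrac g) -> Na star (tofrac g / tofrac f).
  have [f0 [f0nz Jf0]] : exists f, f != 0 /\ J (tofrac f).
    have [f [d [Nd Jf _ fE]]] := numer q Jq; exists f; split=> //.
    apply/eqP => f0; have := mulf_neq0 (Nset_neq0 Nd) q0.
    by rewrite -fE f0 rmorph0 eqxx.
  (* Intersecting c(f)* with D gives a quasi-star-ideal, to which the chain condition applies. *)
  pose clos f := star (content f) `&` dom.
  have qi_clos f : f != 0 -> quasi_star_ideal star (clos f).
    move=> f0'; have Ff := Fbar_content f0'.
    have subclos : submodule dom (clos f).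
      have [A0 AD AM] := submodule_star Ff.
      have [B0 BD BM] := submodule_subring (subring_dom D).
      split=> // [x y [? ?] [? ?]|a x ? [? ?]].
        by split; [apply: AD|apply: BD].
      by split; [apply: AM|apply: BM].
    have Fclos : Fbar (clos f).
      apply: (Fbar_sup subclos Ff) => x fx.
      by split; [apply: star_ext|apply: content_dom fx].
    split; first by split; [split=> //; apply: subIsetr|case: Fclos].
    apply/seteqP; split=> x [fx Dx]; split=> //; first exact: star_ext.
    by move: fx; apply: star_least => // y [].
  have [_ [f [fnz Jf ->]] fmax] := acc_maximal noeth
     (fun A (h : exists f, [/\ f != 0, J (tofrac f) & A = clos f]) =>
        let: ex_intro f (And3 fnz _ e) := h in
        eq_ind_r (quasi_star_ideal star) (qi_clos f fnz) e)
     (ex_intro _ _ (ex_intro _ f0 (And3 f0nz Jf0 erefl))).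
  exists f => // g Jg; apply: Na_divide => // x gx.
  suff: clos f x by case.
  have Ff := Fbar_content fnz.
  have catnz := poly_cat_neq0 g fnz; have Fcat := Fbar_content catnz.
  (* The polynomial f + X^n g is again in J and its closure contains that of f; by maximality they
     agree, so c(g) is absorbed. *)
  rewrite -(fmax (clos (poly_cat f g))).
  - split; last exact: content_dom gx.
    by apply: star_ext => //; apply: content_poly_catr.
  - exists (poly_cat f g); split=> //; rewrite rmorphD rmorphM.
    by apply: JD => //; apply: JM => //; apply: Na_poly.
  - apply: setSI; apply: star_mono => //; exact: content_poly_catl.
exists (tofrac f); first exact: Na_poly.
apply/seteqP; split=> x; last by move=> [r Nr <-]; rewrite mulrC; apply: JM.
move=> Jx; have [g [d [Nd Jg -> _]]] := numer x Jx.
have NaV : Na star (tofrac d)^-1.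
  by have := Na_frac 1 Nd; rewrite rmorph1 div1r.
exists (tofrac g / tofrac f * (tofrac d)^-1).
  by apply: (subringM subring_Na) => //; apply: fmax.
by apply: mulf_divK; rewrite tofrac_eq0.
Qed.

(** * From the Nagata ring back to the base domain *)

Definition extension I : set {fraction {poly D}} :=
  [set tofrac f / tofrac g | f in coefs_in I & g in Nset star].

Lemma ideal_extension I : ideal dom I -> ideal (Na star) (extension I).
Proof.
move=> [subI _]; split; last by move=> _ [f _ [g Ng <-]]; apply: Na_frac.
split.
- exists 0; first exact: coefs_in0.
  by exists 1; [apply: Nset1|rewrite rmorph0 mul0r].
- move=> _ _ [f If [g Ng <-]] [f' If' [g' Ng' <-]].
  exists (g' * f + g * f'); first by apply: coefs_inD => //; apply: coefs_inM.
  exists (g * g'); first exact: NsetM.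
  rewrite addf_div ?Nset_neq0 // rmorphD !rmorphM.
  by congr ((_ + _) / _); rewrite mulrC.
- move=> _ _ [a _ [b Nb <-]] [f If [g Ng <-]].
  exists (a * f); first exact: coefs_inM.
  exists (b * g); first exact: NsetM.
  by rewrite mulf_div !rmorphM.
Qed.

(** From g d = f with c(f) <= I follows d c(g) <= I, and 1 in c(g)* gives d in I*. Thus a
    quasi-star-ideal is recovered from its extension. *)
Lemma extension_contract I (d : D) : nonzero_ideal I ->
  extension I (tofrac d%:P) -> star I (tofrac d).
Proof.
move=> [[subI ID] I0] [f If [g Ng dE]].
have FI : Fbar I by [].
have fE : f = g * d%:P.
  apply: tofrac_inj; rewrite rmorphM; exact: numer_eq (Nset_neq0 Ng) dE.
have [g0 g1] := (NsetP g).1 Ng.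
rewrite -[tofrac d]mulr1;
  apply: (star_scale_mem FI (Fbar_content g0)) g1 => y gy.
rewrite mulrC; apply: star_ext => //; move: y gy; apply: content_sub.
  exact: submodule_preim_scale.
by move=> k /=; rewrite -rmorphM -coefMC -fE; apply: If.
Qed.

Lemma Noetherian_of_Na : acc (ideal (Na star)) -> star_Noetherian star.
Proof.
move=> accNa I qI IS.
have [n|n|N NI] := accNa (fun n => extension (I n)).
- by apply: ideal_extension; case: (qI n) => -[].
- by move=> _ [f If [g Ng <-]]; exists f; [move=> k; apply: IS|exists g].
exists N => n Nn; apply/seteqP; split; last exact: (chain_sub IS).
move=> x Ix; have [nzN ->] := qI N.
have [[[_ ID] _] _] := qI n; have Dx := ID x Ix; split=> //.
case: Dx Ix => d _ <- Id; apply: extension_contract => //.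
rewrite -(NI n Nn); exists d%:P.
  by move=> k; rewrite coefC; case: eqP => // _; rewrite rmorph0;
    case: (qI n) => -[[[]]].
by exists 1; [apply: Nset1|rewrite rmorph1 divr1].
Qed.

Lemma PstarMD_of_Na : Dedekind_domain (Na star) -> PstarMD star.
Proof.
move=> dedNa I nzI [s Is]; have [[subI ID] I0] := nzI.
have sI i : (i < size s)%N -> I s`_i.
  by move=> si; rewrite Is; apply: spanned_gen; apply: mem_nth.
have /choice[d dE] (i : 'I_(size s)) : exists d : D, tofrac d = s`_i.
  by case: (ID _ (sI i (ltn_ord i))) => d _ <-; exists d.
have [j0 dj0] : exists j, d j != 0.
  apply: contrapT => nod; apply: I0; apply/seteqP; split; last by move=> _ ->;
    case: subI.
  rewrite Is; apply: spanned_sub.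
    by split=> // [x y -> ->|a x _ ->] /=; rewrite ?addr0 ?mulr0.
  move=> x /(nthP 0)[i si <-]; have := dE (Ordinal si) => /= <-.
  have [-> |di] := eqVneq (d (Ordinal si)) 0; first by rewrite rmorph0.
  by case: nod; exists (Ordinal si).
have [j| |w [wNa w1]] := @Dedekind_invertible _ _ subring_Na _
  (fun j => tofrac (d j)%:P) dedNa.
- exact: Na_poly.
- by exists j0; rewrite tofrac_eq0 polyC_eq0.
(* A single g clears all products, so that v (i, j) = g w_i d_j is in D[X]. *)
have [g Ng /choice[v vE]] := @Na_common_denominator _
  (fun ij : 'I_(size s) * 'I_(size s) => w ij.1 * tofrac (d ij.2)%:P)
  (fun ij => wNa ij.1 ij.2).
have gE : g = \sum_i v (i, i).
  apply: tofrac_inj; rewrite rmorph_sum -[LHS]mul1r -w1 mulr_suml.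
  by apply: eq_bigr => i _; apply: etrans (vE (i, i)) => /=;
    rewrite [w i * _]mulrC.
have vd i j k : v (i, j) * (d k)%:P = v (i, k) * (d j)%:P.
  apply: tofrac_inj; rewrite !rmorphM /= -!vE /=; exact: mulACAC.
(* This is the k-th coefficient of g w_i, a polynomial over K; by [vd] the choice of j0 does not
   matter. *)
pose y i k := tofrac (v (i, j0))`_k / tofrac (d j0).
have yd i j k : y i k * tofrac (d j) = tofrac (v (i, j))`_k.
  rewrite /y mulrAC -rmorphM -coefMC vd coefMC rmorphM mulfK ?tofrac_eq0 //.
have inv_y i k : inv_ideal I (y i k).
  move=> _ [x Ix <-]; rewrite mulrC; move: x Ix; rewrite Is; apply: spanned_sub.
    by apply: submodule_preim_scale; apply: submodule_subring;
      apply: subring_dom.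
  move=> x /(nthP 0)[j sj <-]; have := dE (Ordinal sj) => /= <-.
  by rewrite mulrC yd; apply: dom_tofrac.
have [g0 g1] := (NsetP g).1 Ng.
have gII : content g `<=` mulM dom I (inv_ideal I).
  apply: content_sub; first exact: submodule_mulM.
  move=> k; rewrite gE coef_sum rmorph_sum.
  have [A0 AD _] := submodule_mulM dom I (inv_ideal I).
  apply: big_ind => //= i _; rewrite -yd mulrC.
  by apply: mulM_gen => //; rewrite dE; apply: sI.
have IID : mulM dom I (inv_ideal I) `<=` dom.
  apply: mulM_sub; first by apply: submodule_subring; apply: subring_dom.
  by move=> x z Ix Iz; apply: Iz; exists x => //; rewrite mulrC.
(* For the inclusion from D, c(g) is one of the finitely generated modules in the union for I I^-1,
   and c(g)* = D* contains every F*. *)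
apply/seteqP; split=> x [F [fF FD] Fx].
  by exists F => //; split=> //; apply: subset_trans FD IID.
exists (content g); first by split=> //; apply: ffin_content.
have [_ ->] := Ng; move: Fx; apply: star_mono => //; first by case: fF.
exact: Fbar_dom.
Qed.

End Nagata.

Theorem theorem4p18 (D : idomainType)
    (star : set {fraction D} -> set {fraction D})
    (hstar : semistar_operation star) :
  [/\ star_Dedekind star <-> PID (Na star),
      PID (Na star) <-> Dedekind_domain (Na star)
    & star_Dedekind star -> Na star = Kr star].
Proof.
have subNa := subring_Na hstar.
have sD_of_D : Dedekind_domain (Na star) -> star_Dedekind star.
  move=> dedNa; split; last exact: PstarMD_of_Na.
  by case: dedNa => _ accNa _ _; apply: Noetherian_of_Na.
split.
- by split=> [|/(PID_Dedekind subNa)]; [apply: Na_PID|apply: sD_of_D].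
- by split=> [|/sD_of_D]; [apply: PID_Dedekind|apply: Na_PID].
- by move=> [_]; apply: Na_eq_Kr.
Qed.
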